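(* Let $\mathsf{D}$ be a Markov category and $T$ a symmetric monoidal affine monad on $\mathsf{D}$ with unit $\eta$ and lax structure maps $\nabla_{X,Y}:TX\otimes TY\to T(X\otimes Y)$. Then the Kleisli category $\mathsf{Kl}(T)$ is again a Markov category in a canonical way, where: the tensor product of objects is that of $\mathsf{D}$; the tensor product of the morphisms represented by $f:A\to TX$ and $g:B\to TY$ is represented by $\nabla_{X,Y}\circ(f\otimes g):A\otimes B\to T(X\otimes Y)$; and the structure isomorphisms and the comonoid structures are the images of those of $\mathsf{D}$ under the canonical functor $\mathsf{D}\to\mathsf{Kl}(T)$ (in particular the comultiplication of $X$ is represented by $\eta_{X\otimes X}\circ\mathsf{copy}_X:X\to T(X\otimes X)$).
   Context: A Markov category is a symmetric monoidal category $(\mathsf{C},\otimes,I)$ with symmetry $\mathsf{swap}_{X,Y}:X\otimes Y\to Y\otimes X$, in which every object $X$ is equipped with morphisms $\mathsf{copy}_X:X\to X\otimes X$ and $\mathsf{del}_X:X\to I$ forming a commutative comonoid (coassociative, counital, cocommutative, with respect to the associators, unitors and symmetry), such that: (i) $\mathsf{del}_{X\otimes Y}$ is $\mathsf{del}_X\otimes\mathsf{del}_Y$ followed by $I\otimes I\cong I$; (ii) $\mathsf{copy}_{X\otimes Y}$ is $\mathsf{copy}_X\otimes\mathsf{copy}_Y$ followed by the canonical isomorphism $(X\otimes X)\otimes(Y\otimes Y)\cong(X\otimes Y)\otimes(X\otimes Y)$ built from associators and the symmetry on the two middle factors; (iii) $\mathsf{del}_Y\circ f=\mathsf{del}_X$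 for every $f:X\to Y$. A monad $(T,\mu,\eta)$ on a symmetric monoidal category $\mathsf{D}$ is symmetric monoidal if it comes equipped with morphisms $\nabla_{X,Y}:TX\otimes TY\to T(X\otimes Y)$, natural in $X$ and $Y$, which together with $\eta_I:I\to TI$ make $T$ into a lax symmetric monoidal functor, and such that $\mu$ and $\eta$ are monoidal transformations, i.e. for all $X,Y$: $\mu_{X\otimes Y}\circ T\nabla_{X,Y}\circ\nabla_{TX,TY}=\nabla_{X,Y}\circ(\mu_X\otimes\mu_Y)$ and $\nabla_{X,Y}\circ(\eta_X\otimes\eta_Y)=\eta_{X\otimes Y}$. The monad is affine if $TI\cong I$ (where $I$ is terminal in $\mathsf{D}$). The Kleisli category $\mathsf{Kl}(T)$ has the objects of $\mathsf{D}$, and its morphisms $X\to Y$ are represented by morphisms $X\to TY$ of $\mathsf{D}$; the canonical functor $\mathsf{D}\to\mathsf{Kl}(T)$ is the identity on objects and sends $f:X\to Y$ to the morphism represented by $\eta_Y\circ f$. *)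

(* Defs.v *)
Set Implicit Arguments.
Unset Strict Implicit.
Unset Printing Implicit Defensive.

Declare Scope cat_scope.
Delimit Scope cat_scope with cat.
Open Scope cat_scope.

Reserved Notation "g ∘ f" (at level 40, left associativity).
Reserved Notation "X ⊗ Y" (at level 38, left associativity).
Reserved Notation "f ⊠ g" (at level 38, left associativity).

(* Equality of parallel morphisms is Leibniz equality. *)
Record Category : Type := {
  ob :> Type;
  hom : ob -> ob -> Type;
  idm : forall X, hom X X;
  comp : forall X Y Z, hom Y Z -> hom X Y -> hom X Z;
  comp_id_l : forall X Y (f : hom X Y), comp (idm Y) f = f;
  comp_id_r : forall X Y (f : hom X Y), comp f (idm X) = f;
  comp_assoc : forall W X Y Z (h : hom Y Z) (g : hom X Y) (f : hom W X),
    comp h (comp g f) = comp (comp h g) f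
}.

Arguments hom {c} X Y.
Arguments idm {c} X.
Arguments comp {c X Y Z} g f.
Notation "g ∘ f" := (comp g f) : cat_scope.

Record Iso (C : Category) (X Y : C) : Type := {
  fwd :> hom X Y;
  bwd : hom Y X;
  bwd_fwd : bwd ∘ fwd = idm X;
  fwd_bwd : fwd ∘ bwd = idm Y
}.

Arguments Iso {C} X Y.

Record Functor (C D : Category) : Type := {
  fob :> C -> D;
  fmap : forall X Y, hom X Y -> hom (fob X) (fob Y);
  fmap_id : forall X, fmap (idm X) = idm (fob X);
  fmap_comp : forall X Y Z (g : hom Y Z) (f : hom X Y),
    fmap (g ∘ f) = fmap g ∘ fmap f
}.

Arguments fmap {C D} F {X Y} f : rename.

Definition iso_image (C D : Category) (F : Functor C D) (X Y : C)
    (i : Iso X Y) : Iso (F X) (F Y).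
Proof.
refine {| fwd := fmap F (fwd i); bwd := fmap F (bwd i) |}.
- rewrite <- fmap_comp, bwd_fwd. apply fmap_id.
- rewrite <- fmap_comp, fwd_bwd. apply fmap_id.
Defined.

Record SymMonData (C : Category) : Type := {
  tens : C -> C -> C;
  tmap : forall X X' Y Y' : C,
    hom X X' -> hom Y Y' -> hom (tens X Y) (tens X' Y');
  unit : C;
  assoc : forall X Y Z : C, Iso (tens (tens X Y) Z) (tens X (tens Y Z));
  lunit : forall X : C, Iso (tens unit X) X;
  runit : forall X : C, Iso (tens X unit) X;
  swap : forall X Y : C, hom (tens X Y) (tens Y X)
}.

Arguments unit {C} s.
Arguments assoc {C} s X Y Z.
Arguments lunit {C} s X.
Arguments runit {C} s X.
Arguments swap {C} s X Y.
Notation "X ⊗ Y" := (tens _ X Y) : cat_scope.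
Notation "f ⊠ g" := (tmap _ f g) : cat_scope.

Record IsSymMon (C : Category) (V : SymMonData C) : Prop := {
  tens_id : forall X Y : C, tmap V (idm X) (idm Y) = idm (tens V X Y);
  tens_comp : forall (X X' X'' Y Y' Y'' : C)
    (f' : hom X' X'') (f : hom X X') (g' : hom Y' Y'') (g : hom Y Y'),
    tmap V (f' ∘ f) (g' ∘ g) = tmap V f' g' ∘ tmap V f g;
  assoc_nat : forall (X X' Y Y' Z Z' : C)
    (f : hom X X') (g : hom Y Y') (h : hom Z Z'),
    assoc V X' Y' Z' ∘ ((f ⊠ g) ⊠ h) = (f ⊠ (g ⊠ h)) ∘ assoc V X Y Z;
  lunit_nat : forall (X X' : C) (f : hom X X'),
    lunit V X' ∘ (idm (unit V) ⊠ f) = f ∘ lunit V X;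
  runit_nat : forall (X X' : C) (f : hom X X'),
    runit V X' ∘ (f ⊠ idm (unit V)) = f ∘ runit V X;
  swap_nat : forall (X X' Y Y' : C) (f : hom X X') (g : hom Y Y'),
    swap V X' Y' ∘ (f ⊠ g) = (g ⊠ f) ∘ swap V X Y;
  pentagon : forall W X Y Z : C,
    assoc V W X (Y ⊗ Z) ∘ assoc V (W ⊗ X) Y Z
    = (idm W ⊠ assoc V X Y Z) ∘ assoc V W (X ⊗ Y) Z ∘ (assoc V W X Y ⊠ idm Z);
  triangle : forall X Y : C,
    (idm X ⊠ lunit V Y) ∘ assoc V X (unit V) Y = runit V X ⊠ idm Y;
  hexagon : forall X Y Z : C,
    (idm Y ⊠ swap V X Z) ∘ assoc V Y X Z ∘ (swap V X Y ⊠ idm Z)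
    = assoc V Y Z X ∘ swap V X (Y ⊗ Z) ∘ assoc V X Y Z;
  swap_invol : forall X Y : C, swap V Y X ∘ swap V X Y = idm (X ⊗ Y)
}.

Definition interchange (C : Category) (V : SymMonData C) (W X Y Z : C) :
    hom (tens V (tens V W X) (tens V Y Z)) (tens V (tens V W Y) (tens V X Z)) :=
  bwd (assoc V W Y (X ⊗ Z))
  ∘ (idm W ⊠ assoc V Y X Z)
  ∘ (idm W ⊠ (swap V X Y ⊠ idm Z))
  ∘ (idm W ⊠ bwd (assoc V X Y Z))
  ∘ assoc V W X (Y ⊗ Z).

Record MarkovData (C : Category) : Type := {
  symmon :> SymMonData C;
  copy : forall X : C, hom X (tens symmon X X);
  del : forall X : C, hom X (unit symmon)
}.

Arguments copy {C} M X : rename.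
Arguments del {C} M X : rename.

Record IsMarkov (C : Category) (M : MarkovData C) : Prop := {
  markov_symmon : IsSymMon M;
  copy_coassoc : forall X : C,
    assoc M X X X ∘ (copy M X ⊠ idm X) ∘ copy M X = (idm X ⊠ copy M X) ∘ copy M X;
  copy_counit_l : forall X : C,
    lunit M X ∘ (del M X ⊠ idm X) ∘ copy M X = idm X;
  copy_counit_r : forall X : C,
    runit M X ∘ (idm X ⊠ del M X) ∘ copy M X = idm X;
  copy_cocomm : forall X : C, swap M X X ∘ copy M X = copy M X;
  del_tens : forall X Y : C,
    del M (X ⊗ Y) = lunit M (unit M) ∘ (del M X ⊠ del M Y);
  copy_tens : forall X Y : C,
    copy M (X ⊗ Y) = interchange M X X Y Y ∘ (copy M X ⊠ copy M Y);
  del_nat : forall (X Y : C) (f : hom X Y), del M Y ∘ f = del M X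
}.

Record Monad (D : Category) : Type := {
  mfun :> Functor D D;
  eta : forall X : D, hom X (mfun X);
  mu : forall X : D, hom (mfun (mfun X)) (mfun X);
  eta_nat : forall (X Y : D) (f : hom X Y), eta Y ∘ f = fmap mfun f ∘ eta X;
  mu_nat : forall (X Y : D) (f : hom X Y),
    mu Y ∘ fmap mfun (fmap mfun f) = fmap mfun f ∘ mu X;
  mu_eta_l : forall X : D, mu X ∘ eta (mfun X) = idm (mfun X);
  mu_eta_r : forall X : D, mu X ∘ fmap mfun (eta X) = idm (mfun X);
  mu_assoc : forall X : D, mu X ∘ fmap mfun (mu X) = mu X ∘ mu (mfun X)
}.

Arguments eta {D} T X : rename.
Arguments mu {D} T X : rename.

(* The unit constraint of the lax structure is [eta T (unit V)]; the unit
   conditions for [eta] and [mu] to be monoidal transformations then hold by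
   the monad laws, so that only the binary ones are required. *)
Record IsSymMonMonad (D : Category) (V : SymMonData D) (T : Monad D)
    (nabla : forall X Y : D, hom (tens V (T X) (T Y)) (T (tens V X Y))) : Prop := {
  nabla_nat : forall (X X' Y Y' : D) (f : hom X X') (g : hom Y Y'),
    fmap T (f ⊠ g) ∘ nabla X Y = nabla X' Y' ∘ (fmap T f ⊠ fmap T g);
  nabla_assoc : forall X Y Z : D,
    fmap T (assoc V X Y Z) ∘ nabla (X ⊗ Y) Z ∘ (nabla X Y ⊠ idm (T Z))
    = nabla X (Y ⊗ Z) ∘ (idm (T X) ⊠ nabla Y Z) ∘ assoc V (T X) (T Y) (T Z);
  nabla_lunit : forall X : D,
    fmap T (lunit V X) ∘ nabla (unit V) X ∘ (eta T (unit V) ⊠ idm (T X))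
    = lunit V (T X);
  nabla_runit : forall X : D,
    fmap T (runit V X) ∘ nabla X (unit V) ∘ (idm (T X) ⊠ eta T (unit V))
    = runit V (T X);
  nabla_swap : forall X Y : D,
    fmap T (swap V X Y) ∘ nabla X Y = nabla Y X ∘ swap V (T X) (T Y);
  mu_monoidal : forall X Y : D,
    mu T (X ⊗ Y) ∘ fmap T (nabla X Y) ∘ nabla (T X) (T Y)
    = nabla X Y ∘ (mu T X ⊠ mu T Y);
  eta_monoidal : forall X Y : D,
    nabla X Y ∘ (eta T X ⊠ eta T Y) = eta T (X ⊗ Y)
}.

Definition IsAffine (D : Category) (V : SymMonData D) (T : Monad D) : Prop :=
  inhabited (Iso (T (unit V)) (unit V)).

Definition Kleisli (D : Category) (T : Monad D) : Category.
Proof.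
refine {|
  ob := ob D;
  hom := fun X Y => hom X (T Y);
  idm := fun X => eta T X;
  comp := fun X Y Z g f => mu T Z ∘ fmap T g ∘ f
|}.
- intros X Y f. rewrite mu_eta_r. apply comp_id_l.
- intros X Y f.
  rewrite <- comp_assoc, <- eta_nat, comp_assoc, mu_eta_l. apply comp_id_l.
- intros W X Y Z h g f.
  rewrite !fmap_comp, !comp_assoc, mu_assoc.
  rewrite <- (comp_assoc (mu T Z) (mu T (T Z))), mu_nat, comp_assoc.
  reflexivity.
Defined.

Definition kleisli_functor (D : Category) (T : Monad D) :
    Functor D (Kleisli T).
Proof.
refine {|
  fob := fun X : D => (X : Kleisli T);
  fmap := fun X Y (f : hom X Y) => eta T Y ∘ f
|}.
- intros X. simpl. rewrite comp_id_r. reflexivity.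
- intros X Y Z g f. simpl.
  rewrite fmap_comp, !comp_assoc, mu_eta_r, comp_id_l, eta_nat. reflexivity.
Defined.

Definition kleisli_symmon (D : Category) (V : SymMonData D) (T : Monad D)
    (nabla : forall X Y : D, hom (tens V (T X) (T Y)) (T (tens V X Y))) :
    SymMonData (Kleisli T) :=
  let J := kleisli_functor T in {|
  tens := fun X Y : Kleisli T => tens V X Y : Kleisli T;
  tmap := fun (X X' Y Y' : D) (f : hom X (T X')) (g : hom Y (T Y')) =>
    nabla X' Y' ∘ (f ⊠ g);
  unit := unit V : Kleisli T;
  assoc := fun X Y Z : D => iso_image J (assoc V X Y Z);
  lunit := fun X : D => iso_image J (lunit V X);
  runit := fun X : D => iso_image J (runit V X);
  swap := fun X Y : D => fmap J (swap V X Y)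
|}.

Definition kleisli_markov (D : Category) (M : MarkovData D) (T : Monad D)
    (nabla : forall X Y : D, hom (tens M (T X) (T Y)) (T (tens M X Y))) :
    MarkovData (Kleisli T) :=
  let J := kleisli_functor T in {|
  symmon := kleisli_symmon nabla;
  copy := fun X : D => fmap J (copy M X);
  del := fun X : D => fmap J (del M X)
|}.

(* Main.v *)
(** The canonical functor [J : D -> Kl(T)] preserves tensors of morphisms
    strictly, so every axiom that only involves structure morphisms (pentagon,
    triangle, hexagon, the comonoid laws, ...) is the image under [J] of the same
    axiom in [D].  Functoriality of the Kleisli tensor is [mu_monoidal], and the
    naturality of the structure isomorphisms is the coherence of [nabla].
    Naturality of [del] needs [T I] to be subterminal: [I] is terminal in [D], as
    counitality together with [lunit I = runit I] forces [del I] to be the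
    identity, and [T I] is isomorphic to [I]. *)
Require Import Defs.

Set Implicit Arguments.
Unset Strict Implicit.
Unset Printing Implicit Defensive.

Section Isomorphisms.

Context (C : Category) (X Y Z : C).

Lemma iso_epi (i : Iso X Y) (f g : hom Y Z) : f ∘ i = g ∘ i -> f = g.
Proof.
intros E.
rewrite <- (comp_id_r f), <- (comp_id_r g), <- (fwd_bwd i), !comp_assoc, E.
reflexivity.
Qed.

Lemma iso_mono (i : Iso Y Z) (f g : hom X Y) : i ∘ f = i ∘ g -> f = g.
Proof.
intros E.
rewrite <- (comp_id_l f), <- (comp_id_l g), <- (bwd_fwd i), <- !comp_assoc, E.
reflexivity.
Qed.

End Isomorphisms.

Section SymmetricMonoidal.

Context (C : Category) (V : SymMonData C) (HV : IsSymMon V).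

(** The left unitor is a natural isomorphism from tensoring with the unit to the identity functor,
    so tensoring with the unit is faithful. *)
Lemma tmap_id_inj (X Y : C) (f g : hom X Y) :
  tmap V (idm (unit V)) f = tmap V (idm (unit V)) g -> f = g.
Proof.
intros E. apply (iso_epi (i := lunit V X)).
rewrite <- !(lunit_nat HV), E. reflexivity.
Qed.

Lemma tmap_inj_id (X Y : C) (f g : hom X Y) :
  tmap V f (idm (unit V)) = tmap V g (idm (unit V)) -> f = g.
Proof.
intros E. apply (iso_epi (i := runit V X)).
rewrite <- !(runit_nat HV), E. reflexivity.
Qed.

Lemma tmap_comp_l (X X' X'' Y Y' : C)
    (f' : hom X' X'') (f : hom X X') (g : hom Y Y') :
  tmap V (f' ∘ f) g = tmap V f' (idm Y') ∘ tmap V f g.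
Proof. rewrite <- (tens_comp HV), comp_id_l. reflexivity. Qed.

Lemma tmap_comp_r (X X' Y Y' Y'' : C)
    (f : hom X X') (g' : hom Y' Y'') (g : hom Y Y') :
  tmap V f (g' ∘ g) = tmap V (idm X') g' ∘ tmap V f g.
Proof. rewrite <- (tens_comp HV), comp_id_l. reflexivity. Qed.

Lemma tmap_iso_epi (X X' Y Z : C) (i : Iso X X') (f g : hom (tens V X' Y) Z) :
  f ∘ tmap V i (idm Y) = g ∘ tmap V i (idm Y) -> f = g.
Proof.
intros E.
rewrite <- (comp_id_r f), <- (comp_id_r g), <- (tens_id HV), <- (fwd_bwd i),
  tmap_comp_l, !comp_assoc, E.
reflexivity.
Qed.

(** Kelly's argument: tensor both sides with the unit, precompose with invertible associators, and
    compare them by the pentagon, the triangle and naturality of [assoc]. *)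
Lemma lunit_tens (X Y : C) :
  lunit V (X ⊗ Y) ∘ assoc V (unit V) X Y = tmap V (lunit V X) (idm Y).
Proof.
apply tmap_id_inj.
apply (iso_epi (i := assoc V (unit V) (unit V ⊗ X) Y)).
apply (tmap_iso_epi (i := assoc V (unit V) (unit V) X)).
rewrite tmap_comp_r, <- !comp_assoc.
rewrite (comp_assoc (idm _ ⊠ assoc V _ _ _)), <- (pentagon HV), comp_assoc.
rewrite (triangle HV), <- (tens_id HV), <- (assoc_nat HV), <- (triangle HV).
rewrite tmap_comp_l, comp_assoc, (assoc_nat HV), comp_assoc. reflexivity.
Qed.

Lemma lunit_unit : fwd (lunit V (unit V)) = runit V (unit V).
Proof.
apply tmap_inj_id.
rewrite <- lunit_tens, <- (triangle HV). f_equal.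
(* What remains is naturality of [lunit] at the morphism [lunit V (unit V)] itself. *)
apply (iso_mono (i := lunit V (unit V))).
rewrite (lunit_nat HV). reflexivity.
Qed.

End SymmetricMonoidal.

Section Markov.

Context (C : Category) (M : MarkovData C) (HM : IsMarkov M).

Lemma del_unit : del M (unit M) = idm (unit M).
Proof.
(* Since [lunit] and [runit] agree at the unit, the left counit law yields a section of [del];
   naturality of [del] then absorbs this section. *)
assert (E : del M (unit M) ∘ (runit M (unit M) ∘ copy M (unit M))
            = idm (unit M)).
{ rewrite comp_assoc, <- (runit_nat (markov_symmon HM)),
    <- (lunit_unit (markov_symmon HM)).
  apply (copy_counit_l HM). }
rewrite <- E. symmetry. apply (del_nat HM).
Qed.

Lemma unit_terminal (X : C) (f g : hom X (unit M)) : f = g.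
Proof.
rewrite <- (comp_id_l f), <- (comp_id_l g), <- del_unit, !(del_nat HM).
reflexivity.
Qed.

End Markov.

Section KleisliMarkov.

Context (D : Category) (M : MarkovData D) (HM : IsMarkov M) (T : Monad D).
Context (nabla : forall X Y : D, hom (tens M (T X) (T Y)) (T (tens M X Y))).
Context (Hnabla : IsSymMonMonad nabla).

Let HV : IsSymMon M := markov_symmon HM.
Let J : Functor D (Kleisli T) := kleisli_functor T.
Let K : SymMonData (Kleisli T) := kleisli_symmon nabla.

(** With [kleisli_comp_r], this eliminates [mu] from the naturality squares, whose structure
    isomorphisms are images under [J]. *)
Lemma kleisli_comp_l (X Y Z : D) (h : hom Y Z) (f : hom X (T Y)) :
  comp (c := Kleisli T) (fmap J h) f = fmap T h ∘ f.
Proof. simpl. rewrite fmap_comp, comp_assoc, mu_eta_r, comp_id_l. reflexivity. Qed.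

Lemma kleisli_comp_r (X Y Z : D) (g : hom Y (T Z)) (h : hom X Y) :
  comp (c := Kleisli T) g (fmap J h) = g ∘ h.
Proof.
simpl. rewrite <- !comp_assoc, (comp_assoc (fmap T g)), <- eta_nat,
  !comp_assoc, mu_eta_l, comp_id_l. reflexivity.
Qed.

Lemma kleisli_tmap_image (X X' Y Y' : D) (f : hom X X') (g : hom Y Y') :
  tmap K (fmap J f) (fmap J g) = fmap J (tmap M f g).
Proof.
simpl. rewrite (tens_comp HV), comp_assoc, (eta_monoidal Hnabla). reflexivity.
Qed.

(** The identity of [Kl(T)] is [eta], not literally an image under [J]; [kleisli_image] therefore
    tries the identity variants before the general rule. *)
Lemma kleisli_tmap_image_id_l (X Y Y' : D) (g : hom Y Y') :
  tmap K (idm (X : Kleisli T)) (fmap J g) = fmap J (tmap M (idm X) g).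
Proof.
rewrite <- kleisli_tmap_image. f_equal. symmetry. apply (fmap_id J).
Qed.

Lemma kleisli_tmap_image_id_r (X X' Y : D) (f : hom X X') :
  tmap K (fmap J f) (idm (Y : Kleisli T)) = fmap J (tmap M f (idm Y)).
Proof.
rewrite <- kleisli_tmap_image. f_equal. symmetry. apply (fmap_id J).
Qed.

Lemma kleisli_tens_comp (X X' X'' Y Y' Y'' : Kleisli T)
    (f' : hom X' X'') (f : hom X X') (g' : hom Y' Y'') (g : hom Y Y') :
  tmap K (f' ∘ f) (g' ∘ g) = tmap K f' g' ∘ tmap K f g.
Proof.
simpl. rewrite !(tens_comp HV), fmap_comp, !comp_assoc.
rewrite <- (mu_monoidal Hnabla).
(* Naturality moves [nabla] past [fmap T f' ⊠ fmap T g']. *)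
rewrite <- (comp_assoc _ (nabla (T _) (T _))), <- (nabla_nat Hnabla).
rewrite !comp_assoc. reflexivity.
Qed.

Lemma kleisli_assoc_nat (X X' Y Y' Z Z' : Kleisli T)
    (f : hom X X') (g : hom Y Y') (h : hom Z Z') :
  assoc K X' Y' Z' ∘ ((f ⊠ g) ⊠ h) = (f ⊠ (g ⊠ h)) ∘ assoc K X Y Z.
Proof.
etransitivity; [apply (kleisli_comp_l (assoc M X' Y' Z')) |].
etransitivity; [| symmetry; apply (kleisli_comp_r _ (assoc M X Y Z))].
simpl in f, g, h |- *.
(* The inner [nabla] is pulled out of each tensor to expose the two sides of [nabla_assoc]. *)
rewrite (tmap_comp_l HV), (tmap_comp_r HV), !comp_assoc, (nabla_assoc Hnabla).
rewrite <- !comp_assoc, (assoc_nat HV). reflexivity.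
Qed.

Lemma kleisli_lunit_nat (X X' : Kleisli T) (f : hom X X') :
  lunit K X' ∘ (idm (unit K) ⊠ f) = f ∘ lunit K X.
Proof.
etransitivity; [apply (kleisli_comp_l (lunit M X')) |].
etransitivity; [| symmetry; apply (kleisli_comp_r _ (lunit M X))].
simpl in f |- *.
(* The Kleisli identity of the unit is the unit constraint of the lax structure, so [nabla_lunit]
   applies once [eta ⊠ f] is factored through [idm ⊠ f]. *)
rewrite <- (lunit_nat HV), <- (nabla_lunit Hnabla), <- !comp_assoc.
rewrite <- (tens_comp HV), comp_id_l, comp_id_r. reflexivity.
Qed.

Lemma kleisli_runit_nat (X X' : Kleisli T) (f : hom X X') :
  runit K X' ∘ (f ⊠ idm (unit K)) = f ∘ runit K X.
Proof.
etransitivity; [apply (kleisli_comp_l (runit M X')) |].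
etransitivity; [| symmetry; apply (kleisli_comp_r _ (runit M X))].
simpl in f |- *.
rewrite <- (runit_nat HV), <- (nabla_runit Hnabla), <- !comp_assoc.
rewrite <- (tens_comp HV), comp_id_l, comp_id_r. reflexivity.
Qed.

Lemma kleisli_swap_nat (X X' Y Y' : Kleisli T) (f : hom X X') (g : hom Y Y') :
  swap K X' Y' ∘ (f ⊠ g) = (g ⊠ f) ∘ swap K X Y.
Proof.
etransitivity; [apply (kleisli_comp_l (swap M X' Y')) |].
etransitivity; [| symmetry; apply (kleisli_comp_r _ (swap M X Y))].
simpl in f, g |- *.
rewrite comp_assoc, (nabla_swap Hnabla), <- !comp_assoc, (swap_nat HV).
reflexivity.
Qed.

Lemma affine_terminal (Haffine : IsAffine M T) (X : D)
    (f g : hom X (T (unit M))) : f = g.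
Proof.
destruct Haffine as [i].
apply (iso_mono (i := i)). apply (unit_terminal HM).
Qed.

End KleisliMarkov.

(* Proves an equation between structure morphisms of [Kl(T)] from the
   corresponding equation [E] in [D]. *)
Ltac kleisli_image HM Hnabla E :=
  let H := fresh in
  match type of Hnabla with
  | @IsSymMonMonad _ _ ?T _ =>
      pose proof (f_equal (fmap (kleisli_functor T)) E) as H;
      rewrite ?(fmap_comp (kleisli_functor T)), ?(fmap_id (kleisli_functor T))
        in H
  end;
  repeat first
    [ rewrite <- (kleisli_tmap_image_id_l HM Hnabla) in H
    | rewrite <- (kleisli_tmap_image_id_r HM Hnabla) in H
    | rewrite <- (kleisli_tmap_image HM Hnabla) in H ];
  exact H.

Lemma kleisli_is_symmon (D : Category) (M : MarkovData D) (HM : IsMarkov M)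
    (T : Monad D)
    (nabla : forall X Y : D, hom (tens M (T X) (T Y)) (T (tens M X Y)))
    (Hnabla : IsSymMonMonad nabla) :
  IsSymMon (kleisli_symmon nabla).
Proof.
pose proof (markov_symmon HM) as HV.
split.
- intros X Y. apply (eta_monoidal Hnabla).
- apply (kleisli_tens_comp HM Hnabla).
- apply (kleisli_assoc_nat HM Hnabla).
- apply (kleisli_lunit_nat HM Hnabla).
- apply (kleisli_runit_nat HM Hnabla).
- apply (kleisli_swap_nat HM Hnabla).
- intros W X Y Z. kleisli_image HM Hnabla (pentagon HV W X Y Z).
- intros X Y. kleisli_image HM Hnabla (triangle HV X Y).
- intros X Y Z. kleisli_image HM Hnabla (hexagon HV X Y Z).
- intros X Y. kleisli_image HM Hnabla (swap_invol HV X Y).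
Qed.

Theorem corollary3p2 (D : Category) (M : MarkovData D) (HM : IsMarkov M)
    (T : Monad D)
    (nabla : forall X Y : D, hom (tens M (T X) (T Y)) (T (tens M X Y)))
    (Hnabla : IsSymMonMonad nabla) (Haffine : IsAffine M T) :
  IsMarkov (kleisli_markov nabla).
Proof.
split.
- apply (kleisli_is_symmon HM Hnabla).
- intros X. kleisli_image HM Hnabla (copy_coassoc HM X).
- intros X. kleisli_image HM Hnabla (copy_counit_l HM X).
- intros X. kleisli_image HM Hnabla (copy_counit_r HM X).
- intros X. kleisli_image HM Hnabla (copy_cocomm HM X).
(* Both sides are morphisms of [D] into [T I], hence equal. *)
- intros X Y. apply (affine_terminal HM Haffine).
- intros X Y.
  (* Unfolding exposes the inverse associators, which [iso_image] sends to their images under [J] by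
     definition. *)
  pose proof (copy_tens HM X Y) as E. unfold interchange in E.
  kleisli_image HM Hnabla E.
- intros X Y f. apply (affine_terminal HM Haffine).
Qed.
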